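(* Let $\mathcal H$ be an infinite dimensional separable complex Hilbert space and let $T$ be a bounded linear operator on $\mathcal H$. Suppose that there exist an increasing sequence of positive integers $\{n_k\}$, a sequence $\{\lambda_{n_k}\}$ in $\mathbb C\setminus\{0\}$ with $|\lambda_{n_k}|\le 1$ for all $k\in\mathbb N$, two dense sets $X,Y\subset\mathcal H$ and a sequence of maps $S_{n_k}:Y\to\mathcal H$ such that: (1) $\|\lambda_{n_k}T^{n_k}x\|\to 0$ as $k\to\infty$ for all $x\in X$; (2) $\left\|\frac{1}{\lambda_{n_k}}S_{n_k}y\right\|\to 0$ as $k\to\infty$ for all $y\in Y$; (3) $T^{n_k}S_{n_k}y\to y$ as $k\to\infty$ for all $y\in Y$. Then there is a vector $x\in\mathcal H$ such that $\{\lambda_{n_k}T^{n_k}x : k\in\mathbb N\}$ is dense in $\mathcal H$. In particular, $x$ is a diskcyclic vector for $T$.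
   Context: A vector $x\in\mathcal H$ is diskcyclic for $T$ if $\{\alpha T^n x : n\ge 0,\ \alpha\in\mathbb C,\ |\alpha|\le 1\}$ is dense in $\mathcal H$. The maps $S_{n_k}$ are not assumed linear or continuous. *)

(* Defs.v *)
From mathcomp Require Import all_boot all_order all_algebra.
From mathcomp Require Import sesquilinear.
From mathcomp Require Import complex.
From mathcomp Require Import all_classical all_reals all_analysis.

Set Implicit Arguments.
Unset Strict Implicit.
Unset Printing Implicit Defensive.

Import Order.TTheory GRing.Theory Num.Theory.
Import numFieldNormedType.Exports.

Local Open Scope classical_set_scope.
Local Open Scope ring_scope.
Local Open Scope complex_scope.

Definition separable_space (T : topologicalType) : Prop :=
  exists D : set T, countable D /\ dense D.

(* No finite family spans V; [vectType] only covers finite dimension. *)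
Definition infinite_dimensional (K : fieldType) (V : lmodType K) : Prop :=
  forall (m : nat) (e : 'I_m -> V),
    exists v : V, forall c : 'I_m -> K, v <> \sum_(i < m) c i *: e i.

Definition bounded_operator (R : realType) (V : normedModType R[i])
    (T : {linear V -> V}) : Prop :=
  exists M : R, forall x : V, `|T x| <= M%:C * `|x|.

Definition diskcyclic (R : realType) (V : normedModType R[i])
    (T : V -> V) (x : V) : Prop :=
  dense [set y : V | exists (m : nat) (a : R[i]),
                       `|a| <= 1 /\ y = a *: iter m T x].

(* Main.v *)
(* By Baire's theorem, a sequence of continuous self-maps [f k] of a separable
   complete normed space has a dense orbit as soon as, for all [u] and [v], some
   [f k] sends a point close to [u] to a point close to [v]. For
   [f k = lam (n k) *: T ^ (n k)] the point
   [z = x + (lam (n k))^-1 *: S (n k) y], with [x] in [X] close to [u], [y] in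
   [Y] close to [v] and [k] large, is such a point: the second term is small,
   and [f k z = lam (n k) *: T ^ (n k) x + T ^ (n k) (S (n k) y)] is close to
   [y]. *)
Require Import Defs.
From mathcomp Require Import all_boot all_order all_algebra.
From mathcomp Require Import sesquilinear.
From mathcomp Require Import complex.
From mathcomp Require Import all_classical all_reals all_analysis.
Import Order.TTheory GRing.Theory Num.Theory.
Import numFieldNormedType.Exports.

Local Open Scope classical_set_scope.
Local Open Scope ring_scope.
Local Open Scope complex_scope.

Lemma dense_normP (K : numFieldType) (V : normedModType K) (A : set V) :
  dense A <-> forall (x : V) (e : K), 0 < e -> exists2 a, A a & `|x - a| < e.
Proof.
split=> [Ad x e e0|Ad O [x Ox] oO].
  have [a [xa Aa]] : ball x e `&` A !=set0.
    apply: Ad; last exact: ball_open.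
    by exists x; exact: ballxx.
  by exists a => //; move: xa; rewrite -ball_normE.
have /nbhs_normP[e /= e0 eO] := open_nbhs_nbhs (conj oO Ox).
by have [a Aa xa] := Ad x e e0; exists a; split => //; exact: eO.
Qed.
Arguments dense_normP {K V} A.

Lemma dense_subset (U : topologicalType) (A B : set U) :
  A `<=` B -> dense A -> dense B.
Proof. by move=> AB Ad O O0 oO; have [x [Ox /AB Bx]] := Ad O O0 oO; exists x. Qed.

(** An injection of [D] into the integers is inverted; [x0] is the default value at integers outside
    its image. *)
Lemma countable_enum (U : Type) (D : set U) : countable D -> D !=set0 ->
  exists d : nat -> U, forall x, D x -> exists i, d i = x.
Proof.
move=> /countable_injP[f finj] [x0 _].
have /choice[d dP] i : exists y, forall x, D x -> f x = i -> y = x.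
  have [[y [Dy fy]]|ny] := pselect (exists y, D y /\ f y = i).
    by exists y => x Dx fx; apply: finj; rewrite ?inE// fy.
  by exists x0 => x Dx fx; exfalso; apply: ny; exists x.
by exists d => x Dx; exists (f x); exact: dP.
Qed.

(** A positive element of [R[i]] is real, so the archimedean property of [R] applies. *)
Lemma complex_archimedean (R : realType) (e : R[i]) :
  0 < e -> exists m : nat, m.+1%:R^-1 < e.
Proof.
move=> e0; have /complex_realP[r er] := gtr0_real e0.
move: e0; rewrite er (ltcR 0) => r0.
have [m mr] : exists m : nat, m.+1%:R^-1 < r.
  exists (Num.truncn r^-1).
  by rewrite -ltf_pV2 ?posrE ?invr_gt0 // invrK truncnS_gt.
exists m; suff -> : m.+1%:R^-1 = (m.+1%:R^-1 : R)%:C :> R[i] by rewrite ltcR.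
by rewrite fmorphV rmorph_nat.
Qed.

(* The library's [Baire] takes its scalars in a [realType], which excludes
   [R[i]]. *)
Theorem baire_archimedean (K : numFieldType)
    (archi : forall e : K, 0 < e -> exists m : nat, m.+1%:R^-1 < e)
    (U : completeNormedModType K) (F : (set U)^nat) :
  (forall m, open (F m)) -> (forall m, dense (F m)) -> dense (\bigcap_m F m).
Proof.
move=> Fo Fd O [x0 Ox0] oO.
have /nbhs_normP[r0 /= r0_gt0 r0O] := open_nbhs_nbhs (conj oO Ox0).
(* The ball of radius [2 s], not just [s], is required to lie in the previous
   one, since the limit is only known to be within [2 s] of the centre. *)
have /choice[g gP] (p : nat * (U * K)) : exists q : U * K, 0 < p.2.2 ->
    [/\ 0 < q.2, q.2 < p.1.+1%:R^-1 &
        forall z, `|q.1 - z| < q.2 + q.2 -> `|p.2.1 - z| < p.2.2 /\ F p.1 z].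
  case: p => m [x r] /=; have [r_gt0|nr] := pselect (0 < r); last first.
    by exists (x, r) => r_gt0; case: nr.
  have [y [By Fy]] : ball x r `&` F m !=set0.
    apply: Fd; last exact: ball_open.
    by exists x; exact: ballxx.
  have /nbhs_normP[e /= e_gt0 eP] : nbhs y (ball x r `&` F m).
    by apply: open_nbhs_nbhs; split=> //; apply: openI => //; exact: ball_open.
  (* Taking [s] below [e / 2] puts the ball of radius [2 s] around [y] inside the open set. *)
  near (0 : K)^'+ => s.
  exists (y, s) => _ /=; split.
  - by near: s; exact: nbhs_right_gt.
  - by near: s; apply: nbhs_right_lt; rewrite invr_gt0.
  move=> z yz; have [] : (ball x r `&` F m) z.
    apply: eP; apply: (lt_trans yz) => /=.
    rewrite [e]splitr ltrD//; near: s; apply: nbhs_right_lt; exact: divr_gt0.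
  by rewrite -ball_normE.
(* Centres and radii of nested balls, starting inside [O]; ball [m.+1] lies in [F m]. *)
pose fix ar m := if m is k.+1 then g (k, ar k) else (x0, r0).
pose a m := (ar m).1; pose r m := (ar m).2.
have r_gt0 m : 0 < r m.
  by elim: m => // m IH; case: (gP (m, ar m) IH).
have rS m : r m.+1 < m.+1%:R^-1 by case: (gP (m, ar m) (r_gt0 m)).
have arS m z : `|a m.+1 - z| < r m.+1 + r m.+1 -> `|a m - z| < r m /\ F m z.
  by case: (gP (m, ar m) (r_gt0 m)) => _ _; apply.
have ball_sub m k z : `|a (k + m)%N - z| < r (k + m)%N -> `|a m - z| < r m.
  elim: k => // k IH kz; apply: IH.
  by apply: (proj1 (arS _ _ _)); apply: (lt_trans kz); rewrite ltrDl.
have a_in m k : (m <= k)%N -> `|a m - a k| < r m.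
  by move=> mk; apply: (ball_sub m (k - m)%N); rewrite subnK// subrr normr0.
have /cauchy_cvg : cauchy (a @ \oo).
  apply: cauchy_exP => e /archi[m me].
  exists (a m.+1); exists m.+1 => // k /= mk; rewrite -ball_normE /=.
  by apply: lt_trans me; apply: lt_trans (rS m); exact: a_in.
rewrite cvg_ex /= => -[l al].
have a_l m : `|a m.+1 - l| < r m.+1 + r m.+1.
  near \oo => k.
  rewrite (le_lt_trans (ler_distD (a k) _ _))// ltrD//.
    by apply: a_in; near: k; exact: nbhs_infty_ge.
  by near: k; apply: cvgr_distC_lt.
exists l; split; first by apply: r0O; exact: (arS 0%N l (a_l 0%N)).1.
by move=> m _; exact: (arS m l (a_l m)).2.
Unshelve. all: by end_near. Qed.

Theorem birkhoff_transitivity (K : numFieldType)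
    (archi : forall e : K, 0 < e -> exists m : nat, m.+1%:R^-1 < e)
    (U : completeNormedModType K) (f : nat -> U -> U) :
  separable_space U -> (forall k, continuous (f k)) ->
  (forall (u v : U) (e : K), 0 < e ->
     exists k z, `|u - z| < e /\ `|v - f k z| < e) ->
  exists x, dense [set f k x | k in [set: nat]].
Proof.
move=> [D [Dc Dd]] f_cont f_trans.
have [d dP] : exists d : nat -> U, forall x, D x -> exists i, d i = x.
  apply: countable_enum Dc _.
  have [//|x [_ Dx]] := Dd setT _ openT; first by exists 0.
  by exists x.
(* A point lying in every [G j m] has an orbit that approaches each [d j] arbitrarily closely, hence
   a dense one. *)
pose G j m := \bigcup_k (f k @^-1` ball (d j) m.+1%:R^-1).
(* Pairs are coded by integers to get one sequence; integers coding no pair give the whole space. *)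
pose F i := if unpickle i is Some (j, m) then G j m else setT.
have [x [_ Fx]] : setT `&` \bigcap_i F i !=set0.
  apply: baire_archimedean => //; last 2 first.
  - by exists 0.
  - exact: openT.
  - rewrite /F => i; case: unpickle => [[j m]|]; last exact: openT.
    apply: bigcup_open => k _; apply: open_comp => [y _|]; first exact: f_cont.
    by apply: ball_open; rewrite invr_gt0.
  - rewrite /F => i; case: unpickle => [[j m]|]; last first.
      by move=> O O0 _; rewrite setIT.
    apply/dense_normP => u e e0.
    near (0 : K)^'+ => s.
    have s0 : 0 < s by near: s; exact: nbhs_right_gt.
    have [k [z [uz vz]]] := f_trans u (d j) s s0.
    exists z; last first.
      by apply: (lt_trans uz); near: s; exact: nbhs_right_lt.
    exists k => //=; rewrite -ball_normE /=; apply: (lt_trans vz).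
    by near: s; apply: nbhs_right_lt; rewrite invr_gt0.
exists x; apply/dense_normP => v e e0.
have e20 : 0 < e / 2 by exact: divr_gt0.
have [y Dy vy] := (dense_normP D).1 Dd v _ e20.
have [j jy] := dP y Dy; have [m me] := archi _ e20.
have := Fx (pickle (j, m)) I; rewrite /F pickleK => -[k _].
rewrite /preimage /= -ball_normE /= jy => yf.
exists (f k x); first by exists k.
rewrite (le_lt_trans (ler_distD y _ _))// [e]splitr ltrD//.
exact: lt_trans me.
Unshelve. all: by end_near. Qed.

Lemma bounded_operator_continuous (R : realType) (V : normedModType R[i])
  (T : {linear V -> V}) : bounded_operator T -> continuous T.
Proof.
move=> [M TM]; apply/bounded_linear_continuous/linear_boundedP.
near=> r => x; apply: (le_trans (TM x)); rewrite ler_wpM2r//.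
by near: r; apply: nbhs_pinfty_ge; apply/complex_realP; exists M.
Unshelve. all: by end_near. Qed.

Lemma iter_continuous (U : topologicalType) (f : U -> U) (m : nat) :
  continuous f -> continuous (iter m f).
Proof.
move=> fc; elim: m => [|m IH] x; first exact: cvg_id.
by apply: continuous_comp; [exact: IH|exact: fc].
Qed.

(* A Hilbert space is a complete normed module over R[i] whose norm comes from
   the inner product [dot], linear in its first argument and conjugate-linear
   in its second. Norms take their values in R[i], as nonnegative reals; the
   copy R[i]^o of R[i] is the one carrying the usual topology of the complex
   numbers. Elements of the coerced type [Y] are the vectors of the set [Y]. *)
Theorem theorem2p6 (R : realType) (H : completeNormedModType R[i])
  (dot : {dot H for @Num.conj R[i]})
  (norm_dot : forall x : H, `|x| ^+ 2 = dot x x)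
  (H_infdim : infinite_dimensional H)
  (H_separable : separable_space H)
  (T : {linear H -> H}) (T_bounded : bounded_operator T)
  (n : nat -> nat)
  (n_gt0 : forall k : nat, (0 < n k)%N)
  (n_incr : forall j k : nat, (j < k)%N -> (n j < n k)%N)
  (lam : nat -> R[i])
  (lam_neq0 : forall k : nat, lam (n k) != 0)
  (lam_le1 : forall k : nat, `|lam (n k)| <= 1)
  (X Y : set H) (X_dense : dense X) (Y_dense : dense Y)
  (S : nat -> Y -> H)
  (hX : forall x : H, X x ->
     `|lam (n k) *: iter (n k) T x| @[k --> \oo] --> (0 : R[i]^o))
  (hS : forall y : Y,
     `|(lam (n k))^-1 *: S (n k) y| @[k --> \oo] --> (0 : R[i]^o))
  (hTS : forall y : Y,
     iter (n k) T (S (n k) y) @[k --> \oo] --> (\val y : H)) :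
  exists x : H,
    dense ([set lam (n k) *: iter (n k) T x | k in [set: nat]] : set H) /\
    diskcyclic T x.
Proof.
have iterD m u v : iter m T (u + v) = iter m T u + iter m T v.
  by elim: m => //= m ->; rewrite linearD.
have iterZ m c u : iter m T (c *: u) = c *: iter m T u.
  by elim: m => //= m ->; rewrite linearZ.
have [x x_dense] : exists x,
    dense [set lam (n k) *: iter (n k) T x | k in [set: nat]].
  apply: (birkhoff_transitivity _ (@complex_archimedean R) H
    (fun k x => lam (n k) *: iter (n k) T x)) => // [k x|u v e e0].
    apply: cvgZl_tmp; apply: iter_continuous.
    exact: bounded_operator_continuous.
  have e20 : 0 < e / 2 by exact: divr_gt0.
  (* The distance from [v] to the image splits into [e / 2] for [v] to [y] and two errors of
     [e / 4], from [hX] and [hTS]. *)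
  have e40 : 0 < e / 2 / 2 by exact: divr_gt0.
  have [x Xx ux] := (dense_normP X).1 X_dense u _ e20.
  have [y Yy vy] := (dense_normP Y).1 Y_dense v _ e20.
  pose y' : Y := exist _ y (mem_set Yy).
  near \oo => k.
  have xk : `|lam (n k) *: iter (n k) T x| < e / 2 / 2.
    by near: k; apply: cvgr0_norm_lt => //; exact/norm_cvg0P/hX.
  have Sk : `|(lam (n k))^-1 *: S (n k) y'| < e / 2.
    by near: k; apply: cvgr0_norm_lt => //; exact/norm_cvg0P/hS.
  have yk : `|y - iter (n k) T (S (n k) y')| < e / 2 / 2.
    near: k; exact: cvgr_dist_lt (hTS y') _ _.
  exists k, (x + (lam (n k))^-1 *: S (n k) y'); split.
    by rewrite opprD addrA (le_lt_trans (ler_normB _ _))// [e]splitr ltrD.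
  rewrite iterD iterZ scalerDr scalerA mulfV// scale1r.
  rewrite (le_lt_trans (ler_distD y _ _))// [e]splitr ltrD//.
  rewrite opprD addrCA addrC (le_lt_trans (ler_normB _ _))//.
  by rewrite [e / 2]splitr ltrD.
(* Since [lam (n k)] lies in the closed unit disk, the disk orbit contains this dense set. *)
exists x; split=> //; apply: dense_subset x_dense => _ [k _ <-].
by exists (n k), (lam (n k)).
Unshelve. all: by end_near. Qed.
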